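(* Let $F:\mathbb{R}^d\to\mathcal{CC}(\mathbb{R}^d)$ be relaxed one-sided Lipschitz with constant $l<0$ and $L$-Lipschitz, and let $x_0\in\mathbb{R}^d$ and $\bar y\in\mathbb{R}^d$ be given. If $d>1$ and $L\le-\sqrt{2}\,l$, then the iteration \[x_{n+1}:=x_n+\frac{l}{L^2}\big(\bar y-\mathrm{Proj}(\bar y,F(x_n))\big)\] converges to a solution $\bar x\in S_F(\bar y):=\{x\in\mathbb{R}^d:\ \bar y\in F(x)\}$ and satisfies \[\mathrm{dist}(x_n,S_F(\bar y))\le-\frac{1}{2l}\,\kappa^{n-1}\,\mathrm{dist}(\bar y,F(x_0))\] and \[|x_n-\bar x|\le-\frac{l}{L^2}\,\frac{\kappa^n}{1-\kappa}\,\mathrm{dist}(\bar y,F(x_0))\] for $n\ge1$, where $\kappa:=\frac{\sqrt{L^2-l^2}}{L}$.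
   Context: $\mathbb{R}^d$ carries the Euclidean norm $|\cdot|$ and Euclidean inner product $\langle\cdot,\cdot\rangle$. $\mathcal{CC}(\mathbb{R}^d)$ is the family of nonempty compact convex subsets of $\mathbb{R}^d$. For sets $A,B$, $\mathrm{dist}(A,B):=\sup_{a\in A}\inf_{b\in B}|a-b|$ (for a point $y$, $\mathrm{dist}(y,B):=\inf_{b\in B}|y-b|$) and $\mathrm{dist}_H(A,B):=\max\{\mathrm{dist}(A,B),\mathrm{dist}(B,A)\}$. For $y\in\mathbb{R}^d$ and $A\in\mathcal{CC}(\mathbb{R}^d)$, $\mathrm{Proj}(y,A)$ is the unique point of $A$ with $|y-\mathrm{Proj}(y,A)|=\mathrm{dist}(y,A)$. A map $F:\mathbb{R}^d\to\mathcal{CC}(\mathbb{R}^d)$ is: $L$-Lipschitz, with $L\ge0$, if $\mathrm{dist}_H(F(x),F(x'))\le L|x-x'|$ for all $x,x'\in\mathbb{R}^d$; relaxed one-sided Lipschitz with constant $l\in\mathbb{R}$ ($l$-ROSL) if for any $x,x'\in\mathbb{R}^d$ and $y\in F(x)$ there exists $y'\in F(x')$ with $\langle y-y',x-x'\rangle\le l|x-x'|^2$. Convention: $\kappa^0=1$. *)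

(* Defs.v *)
From HB Require Import structures.
From mathcomp Require Import all_boot all_order all_algebra.
From mathcomp Require Import all_classical all_reals all_analysis.
Import Order.TTheory GRing.Theory Num.Theory.
Import numFieldNormedType.Exports.

Set Implicit Arguments.
Unset Strict Implicit.
Unset Printing Implicit Defensive.

Local Open Scope classical_set_scope.
Local Open Scope ring_scope.

(* R^d is 'rV[R]_d. The library norm `|x| on row vectors is the sup norm, so
   the Euclidean inner product and norm are defined here. The library topology
   on 'rV[R]_d (used for compactness and for limits) is the Euclidean one,
   because the two norms are equivalent. *)

Definition dotp (R : realType) (d : nat) (x y : 'rV[R]_d) : R :=
  \sum_(i < d) x 0 i * y 0 i.

Definition enorm (R : realType) (d : nat) (x : 'rV[R]_d) : R :=
  Num.sqrt (dotp x x).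

Definition CC (R : realType) (d : nat) : set (set 'rV[R]_d) :=
  [set A : set 'rV[R]_d | [/\ A !=set0, compact A & convex_set A]].

(* The real-valued inf and sup return 0 on sets that are empty or unbounded.
   The values below are thus the usual ones for nonempty B and, in dist_set
   and dist_H, nonempty bounded A and B. *)

Definition dist_pt (R : realType) (d : nat) (y : 'rV[R]_d)
    (B : set 'rV[R]_d) : R :=
  inf [set enorm (y - b) | b in B].

Definition dist_set (R : realType) (d : nat) (A B : set 'rV[R]_d) : R :=
  sup [set dist_pt a B | a in A].

Definition dist_H (R : realType) (d : nat) (A B : set 'rV[R]_d) : R :=
  Num.max (dist_set A B) (dist_set B A).

(* For A in CC the nearest point exists and is unique, so that the choice made
   by xget is forced and its default value y is irrelevant. *)
Definition Proj (R : realType) (d : nat) (y : 'rV[R]_d)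
    (A : set 'rV[R]_d) : 'rV[R]_d :=
  xget y [set p | A p /\ enorm (y - p) = dist_pt y A].

Definition Lipschitz_mv (R : realType) (d : nat) (L : R)
    (F : 'rV[R]_d -> set 'rV[R]_d) : Prop :=
  0 <= L /\ forall x x' : 'rV[R]_d, dist_H (F x) (F x') <= L * enorm (x - x').

Definition ROSL (R : realType) (d : nat) (l : R)
    (F : 'rV[R]_d -> set 'rV[R]_d) : Prop :=
  forall x x' y : 'rV[R]_d, F x y ->
    exists2 y' : 'rV[R]_d, F x' y' &
      dotp (y - y') (x - x') <= l * enorm (x - x') ^+ 2.

Definition solset (R : realType) (d : nat)
    (F : 'rV[R]_d -> set 'rV[R]_d) (ybar : 'rV[R]_d) : set 'rV[R]_d :=
  [set x | F x ybar].

(* Main.v *)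
Require Import Defs.
From HB Require Import structures.
From mathcomp Require Import all_boot all_order all_fingroup all_algebra.
From mathcomp Require Import zify ring lra.
From mathcomp Require Import all_classical all_reals all_analysis.
Import Order.TTheory GRing.Theory Num.Theory.
Import numFieldNormedType.Exports.
Set Implicit Arguments.
Unset Strict Implicit.
Unset Printing Implicit Defensive.
Local Open Scope classical_set_scope.
Local Open Scope ring_scope.

(** Write [e(x) = ybar - Proj ybar (F x)] for the residual, so that
    [|e(x)| = dist(ybar, F x)], and let [x' = x + (l / L^2) e(x)] be the next
    iterate.

    Contraction: [|e(x')| <= kappa |e(x)|] ([contraction]). The relaxed
    condition yields one point of [F x'] that is good in the direction [e(x)],
    while the Lipschitz condition yields another one that is close to
    [Proj ybar (F x)], and nothing forces them to coincide. The two hypotheses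
    are therefore used along different segments: the Lipschitz condition
    carries [Proj ybar (F x)] to a point of [F z] for an auxiliary [z] on the
    half-line from [x'] in the direction [e(x')], and the relaxed condition
    carries that point to [F x'] along this very half-line, where its gain is
    measured against [e(x')]. Every such [z] gives an inequality
    ([contraction_family]), and the best choice of [z] gives the factor
    [kappa]. The radicand in [kappa] is nonnegative since the two constants
    satisfy [- l <= L] ([rosl_le_lip]).

    Convergence: the steps are bounded by a geometric sequence of ratio
    [kappa < 1] ([cvg_geometric_steps]), and the limit has zero residual
    because the residual norm is Lipschitz ([dist_pt_lip]).

    Distance to the solution set: there is a solution [xb] in the ball
    [-l |x - xb|^2 <= <e(x), x - xb>] ([localized_solution]), and it satisfies
    [|e(x)| <= L |x - xb|]. If [L^2 <= 2 l^2], expanding [|x' - xb|^2] turns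
    these two bounds into [|x' - xb| <= - |e(x)| / (2 l)]
    ([solution_near_step]), and the contraction finishes.

    The localized solution is a fixed point. Retract the space radially from
    [x] onto the ball; a fixed point of
    [z |-> rho z + (Proj ybar (F (x + rho z)) - ybar)], which exists by Brouwer's
    theorem, is a solution unless [Proj ybar (F (x + rho z)) - ybar] is a positive
    multiple of [z] with [z] outside the ball; the relaxed condition between
    [x] and [x + rho z] and the obtuse angle at the projection exclude this.

    Brouwer's theorem is derived from a cubical Sperner lemma ([kuhn_cube])
    which is proved with determinants instead of counting: the signed sum over
    all simplices of the determinants of their labels vanishes on a discrete
    torus ([sum_det_simplex_mx]). *)

(** * A cubical Sperner lemma *)

Section Kuhn.
Variables m N : nat.
Notation V := {ffun 'I_m.+1 -> 'I_N.+2}.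

(** A simplex of the triangulated torus is a base point [v] and a permutation
    [p]: its vertex number [t] has moved one step along each of the [t]
    coordinates that [p] ranks first. *)
Definition simplex_vertex (v : V) (p : {perm 'I_m.+1}) (t : nat) : V :=
  [ffun i => v i + (p i < t)%N%:R].

(** Row [t] holds the homogeneous coordinates [(1, s (vertex t))] of the labels,
    so that the determinant is the oriented volume of the labelled simplex. *)
Definition simplex_mx (s : V -> 'I_m.+1 -> bool) v p : 'M[int]_m.+2 :=
  \matrix_(t, j)
    if unlift ord0 j is Some i then (s (simplex_vertex v p t) i)%:R else 1.

Definition facet_det (s : V -> 'I_m.+1 -> bool) v p (i : 'I_m.+2) : int :=
  \det (\matrix_(t < m.+1, j < m.+1)
    (s (simplex_vertex v p (lift i t)) j)%:R : 'M[int]_m.+1).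

Lemma det_simplex_mx s v p :
  \det (simplex_mx s v p) = \sum_(i < m.+2) (-1) ^+ i * facet_det s v p i.
Proof.
rewrite (expand_det_col _ ord0); apply: eq_bigr => i _.
rewrite mxE unlift_none mul1r /cofactor addn0; congr (_ * \det _).
by apply/matrixP => t j; rewrite !mxE liftK.
Qed.

(** The facet opposite an intermediate vertex [i] is shared by the simplex whose
    permutation exchanges the ranks [i - 1] and [i]; the signs are opposite. *)
Lemma facet_det_inner s (i : 'I_m.+2) : i != ord0 -> i != ord_max ->
  \sum_v \sum_(p : {perm 'I_m.+1}) (-1) ^+ p * facet_det s v p i = 0.
Proof.
move=> i0 im; apply: big1 => v _; set S := \sum_p _.
suff: S = - S by move=> H; lia.
have i_gt0 : (0 < i)%N by rewrite lt0n; exact: i0.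
have i_lt : (i < m.+1)%N.
  by rewrite ltn_neqAle -ltnS ltn_ord andbT; exact: im.
pose a : 'I_m.+1 := inord i.-1; pose b : 'I_m.+1 := inord i.
have va : a = i.-1 :> nat by rewrite inordK //; lia.
have vb : b = i :> nat by rewrite inordK.
have ab : a != b by rewrite -val_eqE /= va vb; lia.
rewrite {1}/S (reindex_inj (mulIg (tperm a b))) /S -sumrN.
apply: eq_bigr => p _; rewrite odd_permM odd_tperm ab addbT signrN mulNr.
congr (- (_ * \det _)); apply/matrixP => t j; rewrite !mxE; congr ((s _ _)%:R).
apply/ffunP => x; rewrite !ffunE permM; congr (_ + (nat_of_bool _)%:R).
have ti : bump i t != i :> nat by rewrite eq_sym neq_bump.
rewrite /=; case: tpermP => [-> | -> |//]; rewrite ?va ?vb; lia.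
Qed.

(** The facet opposite the first vertex is the facet opposite the last vertex
    of the simplex that starts one step further, with the ranks rotated. *)
Lemma facet_det_ends s :
  \sum_v \sum_(p : {perm 'I_m.+1}) (-1) ^+ p * facet_det s v p ord0
  = (-1) ^+ m *
    \sum_v \sum_(p : {perm 'I_m.+1}) (-1) ^+ p * facet_det s v p ord_max.
Proof.
pose c : {perm 'I_m.+1} := lift_perm ord0 ord_max 1.
pose sh (p : {perm 'I_m.+1}) : V := [ffun i => (p i == ord0)%:R].
rewrite exchange_big [in RHS]exchange_big /= [in RHS](reindex_inj (mulIg c)).
rewrite mulr_sumr; apply: eq_bigr => p _.
rewrite [in RHS](reindex_inj (addIr (sh p))) mulr_sumr; apply: eq_bigr => v _.
rewrite odd_permM odd_lift_perm odd_perm1 addbF /= signr_addb mulrA mulrCA -mulrA.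
rewrite signr_odd -exprMn mulrNN mulr1 expr1n mul1r.
congr (_ * \det _); apply/matrixP => t j; rewrite !mxE; congr ((s _ _)%:R).
apply/ffunP => x; rewrite !ffunE permM -addrA -natrD; congr (_ + _%:R).
rewrite /= /bump leq0n [(m.+1 <= t)%N]leqNgt ltn_ord add0n add1n.
case: (unliftP ord0 (p x)) => [y ->|->].
  by rewrite lift_perm_lift perm1 /= /bump leq0n [(m <= y)%N]leqNgt ltn_ord.
by rewrite lift_perm_id eqxx /=; have := ltn_ord t; lia.
Qed.

(** Each facet occurs in two simplices of the torus with opposite orientations,
    as in the discrete form of Stokes' theorem without boundary. *)
Lemma sum_det_simplex_mx s :
  \sum_v \sum_(p : {perm 'I_m.+1}) (-1) ^+ p * \det (simplex_mx s v p) = 0.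
Proof.
under eq_bigr do under eq_bigr do rewrite det_simplex_mx mulr_sumr.
under eq_bigr do rewrite exchange_big.
rewrite exchange_big /=.
under eq_bigr => i _.
  under eq_bigr do under eq_bigr do rewrite mulrCA.
  under eq_bigr do rewrite -mulr_sumr.
  rewrite -mulr_sumr; over.
rewrite big_ord_recl big_ord_recr [X in _ + (X + _)]big1 => [|i _]; last first.
  rewrite facet_det_inner ?mulr0 //.
  by rewrite -val_eqE /= /bump /=; have := ltn_ord i; lia.
have -> : lift ord0 (ord_max : 'I_m.+1) = ord_max :> 'I_m.+2 by apply/val_inj.
by rewrite add0r facet_det_ends /= mul1r exprS mulN1r mulNr subrr.
Qed.

(** A coordinate that is constant along the simplex gives a zero column or a
    copy of the column of ones. *)
Lemma det_simplex_mx_const s v p i b :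
  (forall t : 'I_m.+2, s (simplex_vertex v p t) i = b) -> \det (simplex_mx s v p) = 0.
Proof.
move=> sb; case: b sb => sb.
  rewrite -det_tr; apply: (@determinant_alternate _ _ _ ord0 (lift ord0 i)) => // t.
  by rewrite !mxE unlift_none liftK sb.
rewrite (expand_det_col _ (lift ord0 i)) big1 // => t _.
by rewrite !mxE liftK sb mul0r.
Qed.

Lemma det_simplex_mx_ranks s v p :
  (forall (t : 'I_m.+2) i, s (simplex_vertex v p t) i = (p i < t)%N) ->
  \det (simplex_mx s v p) = (-1) ^+ p.
Proof.
move=> sE; pose B : 'M[int]_m.+2 := \matrix_(t, j) (j <= t)%N%:R.
have -> : simplex_mx s v p = col_perm (lift_perm ord0 ord0 p) B.
  apply/matrixP => t j; rewrite !mxE.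
  case: unliftP => [i ->|->]; last by rewrite lift_perm_id.
  by rewrite lift_perm_lift sE.
rewrite col_permE det_mulmx det_perm odd_permV odd_lift_perm /=.
rewrite det_trig ?big1 ?mul1r // => [i _|]; first by rewrite mxE leqnn.
by apply/is_trig_mxP => i j ij; rewrite mxE leqNgt ij.
Qed.
End Kuhn.

Lemma simplex_vertex_val m N (v : {ffun 'I_m.+1 -> 'I_N.+2}) p t i :
  (v i <= N)%N -> simplex_vertex v p t i = (v i + (p i < t))%N :> nat.
Proof.
move=> vi; rewrite ffunE; case: (p i < t)%N; last by rewrite addr0 addn0.
by rewrite /= modn_small // [(1 %% _)%N]modn_small //; lia.
Qed.

Lemma simplex_vertex_wrap m N (v : {ffun 'I_m.+1 -> 'I_N.+2}) p t i :
  v i = N.+1 :> nat ->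
  simplex_vertex v p t i = (if (p i < t)%N then 0 else N.+1)%N :> nat.
Proof.
move=> vi; rewrite ffunE; case: (p i < t)%N; last by rewrite addr0.
by rewrite /= [(1 %% _)%N]modn_small // vi addn1 modnn.
Qed.

(** Embed the grid [0..k]^(m+1) with a margin of one layer in a torus, with labels
    [c] on the margin. Simplices that leave the grid contribute the same amount
    for [s'] as for the coordinatewise labelling [c], hence so do the simplices
    of the grid; for [c] this is a nonzero factorial, concentrated on a single
    cube. Some simplex of the grid thus has a nonzero determinant, and then no
    coordinate of its labels is constant. *)
Theorem kuhn_cube m k (s : {ffun 'I_m.+1 -> nat} -> 'I_m.+1 -> bool) :
  (0 < k)%N ->
  (forall (v : {ffun _}) i, v i = 0%N -> s v i = false) ->
  (forall (v : {ffun _}) i, v i = k -> s v i = true) ->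
  exists2 v : {ffun 'I_m.+1 -> nat}, forall i, (v i < k)%N &
    forall i b, exists2 a : {ffun 'I_m.+1 -> nat},
      forall j, (v j <= a j <= (v j).+1)%N & s a i = b.
Proof.
move=> k_gt0 s_lo s_hi.
(* Torus index 0 and k + 2 form the margin; grid coordinates are shifted by 1. *)
pose c (u : {ffun 'I_m.+1 -> 'I_k.+3}) i : bool := (2 <= u i)%N.
pose in_grid (u : {ffun 'I_m.+1 -> 'I_k.+3}) := [forall i, 0 < u i <= k.+1]%N.
pose coords (u : {ffun 'I_m.+1 -> 'I_k.+3}) : {ffun 'I_m.+1 -> nat} := [ffun i => (u i).-1].
pose s' (u : {ffun 'I_m.+1 -> 'I_k.+3}) i := if in_grid u then s (coords u) i else c u i.
pose in_cube (u : {ffun 'I_m.+1 -> 'I_k.+3}) := [forall i, 0 < u i <= k]%N.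
have outer_det u p : ~~ in_cube u ->
    \det (simplex_mx s' u p) = \det (simplex_mx c u p).
  (* A simplex that wraps around has all its vertices in the margin; any other
     one has a coordinate that is constant for both labellings. *)
  case: (boolP [exists i, u i == k.+2 :> nat]) => [/existsP[i /eqP ui] _|noti].
    congr (\det _); apply/matrixP => t j; rewrite !mxE.
    case: (unlift _ _) => // j'; rewrite /s' ifF //.
    by apply/negbTE/forallPn; exists i; rewrite (simplex_vertex_wrap _ _ ui); case: ifP; lia.
  move=> /forallPn[i ui].
  have uk : (u i <= k.+1)%N.
    move/existsPn: noti => /(_ i); have := ltn_ord (u i); lia.
  pose b := (0 < u i)%N.
  rewrite !(@det_simplex_mx_const _ _ _ u p i b) // => t.
    by rewrite /c simplex_vertex_val // /b; lia.
  rewrite /s' /c simplex_vertex_val //.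
  case: ifP => [/forallP/(_ i)|_]; last by rewrite /b; lia.
  rewrite simplex_vertex_val // => g; rewrite /b.
  have [u0|u0] := posnP (u i).
    by apply: s_lo; rewrite ffunE simplex_vertex_val //; lia.
  by apply: s_hi; rewrite ffunE simplex_vertex_val //; lia.
have := etrans (sum_det_simplex_mx s') (esym (sum_det_simplex_mx c)).
have sum_split (f : {ffun 'I_m.+1 -> 'I_k.+3} -> int) :
    \sum_u f u = \sum_(u | in_cube u) f u + \sum_(u | ~~ in_cube u) f u.
  by rewrite (bigID in_cube).
rewrite !sum_split.
have -> : \sum_(u | ~~ in_cube u)
      \sum_(p : {perm 'I_m.+1}) (-1) ^+ p * \det (simplex_mx s' u p)
    = \sum_(u | ~~ in_cube u)
      \sum_(p : {perm 'I_m.+1}) (-1) ^+ p * \det (simplex_mx c u p).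
  by apply: eq_bigr => u nu; apply: eq_bigr => p _; rewrite outer_det.
move/addIr.
(* [c] jumps from 0 to 1 only between the torus indices 1 and 2. *)
pose u1 : {ffun 'I_m.+1 -> 'I_k.+3} := [ffun _ => 1].
have u1E i : u1 i = 1%N :> nat by rewrite ffunE.
have u1_in : in_cube u1 by apply/forallP => i; rewrite u1E; lia.
rewrite [RHS](bigD1 u1) //= [X in _ + X]big1 => [|u /andP[u_in uu1]]; last first.
  have /existsP[i ui] : [exists i, u i != 1].
    apply: contraR uu1 => /existsPn h; apply/eqP/ffunP => i.
    by rewrite ffunE; apply/eqP; rewrite -[_ == _]negbK h.
  apply: big1 => p _; rewrite (@det_simplex_mx_const _ _ _ u p i true) ?mulr0 // => t.
  have := forallP u_in i; rewrite /c => ui'.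
  rewrite simplex_vertex_val; last by lia.
  by move: ui; rewrite -val_eqE /= ?[(1 %% _)%N]modn_small //; lia.
rewrite addr0.
have -> : \sum_(p : {perm 'I_m.+1}) (-1) ^+ p * \det (simplex_mx c u1 p)
    = (m.+1)`!%:R.
  rewrite -card_Sn -sumr_const; apply: eq_bigr => p _.
  rewrite det_simplex_mx_ranks; first by rewrite -expr2 sqrr_sign.
  by move=> t i; rewrite /c simplex_vertex_val u1E ?add1n //; lia.
move=> sumE.
have [u /andP[u_in]] : exists u, in_cube u &&
    [exists p : {perm 'I_m.+1}, \det (simplex_mx s' u p) != 0].
  apply/existsP; apply: contraT => /existsPn h.
  have : ((m.+1)`!%:R : int) != 0 by rewrite pnatr_eq0 -lt0n fact_gt0.
  rewrite -sumE big1 ?eqxx // => u u_in; apply: big1 => p _.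
  have := h u; rewrite u_in /= => /existsPn/(_ p); rewrite negbK => /eqP ->.
  by rewrite mulr0.
move=> /existsP[p dn0]; have u_inP i := forallP u_in i.
have uk i : (u i <= k.+1)%N by have := u_inP i; lia.
exists (coords u) => [i|i b]; first by rewrite ffunE; have := u_inP i; lia.
case: (boolP [forall t : 'I_m.+2, s' (simplex_vertex u p t) i == ~~ b]) => [/forallP h|].
  move: dn0; rewrite (@det_simplex_mx_const _ _ _ u p i (~~ b)) ?eqxx // => t.
  exact/eqP.
move=> /forallPn[t sb]; exists (coords (simplex_vertex u p t)) => [j|].
  by rewrite ![coords _ _]ffunE simplex_vertex_val //; have := u_inP j; lia.
have gu : in_grid (simplex_vertex u p t).
  by apply/forallP => j; rewrite simplex_vertex_val //; have := u_inP j; lia.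
by move: sb; rewrite /s' gu; case: (s _ _); case: b.
Qed.

(** * Brouwer's fixed point theorem *)

(** At grid points the label [i] records whether [f] moves the coordinate [i]
    down; the bound on [f] gives the labels that are required on the faces of
    the cube. *)
Lemma brouwer_grid (R : realType) m (M : R) (f : 'rV[R]_m.+1 -> 'rV[R]_m.+1) k :
  0 < M -> (forall x i, `|f x 0 i| <= M) ->
  exists2 u : 'rV[R]_m.+1, forall i, `|u 0 i| <= M &
    forall i (b : bool), exists2 a : 'rV[R]_m.+1,
      forall j, `|u 0 j - a 0 j| <= 2 * M / k.+1%:R &
      if b then f a 0 i <= a 0 i else a 0 i <= f a 0 i.
Proof.
move=> M_gt0 fM; pose h := 2 * M / k.+1%:R.
have h_gt0 : 0 < h by rewrite divr_gt0 ?mulr_gt0.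
have hk : k.+1%:R * h = 2 * M by rewrite mulrC divfK.
pose g (v : {ffun 'I_m.+1 -> nat}) : 'rV[R]_m.+1 := \row_i (- M + (v i)%:R * h).
(* On a lower face the label must be false even if [f] fixes the coordinate. *)
pose s (v : {ffun 'I_m.+1 -> nat}) i := (v i != 0)%N && (f (g v) 0 i <= g v 0 i).
have fM' x i : - M <= f x 0 i <= M by rewrite -ler_norml.
have [||v vk sv] := @kuhn_cube m k.+1 s isT.
- by move=> v i vi; rewrite /s vi.
- move=> v i vi; rewrite /s vi /= mxE vi hk.
  by have /andP[_] := fM' (g v) i; lra.
exists (g v) => [i|i b].
  rewrite mxE ler_norml; apply/andP; split.
    by rewrite lerDl mulr_ge0 // ltW.
  have : (v i)%:R * h <= k.+1%:R * h by rewrite ler_pM2r // ler_nat ltnW.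
  by rewrite hk; lra.
have [a av sa] := sv i b; exists (g a) => [j|].
  rewrite !mxE opprD opprK addrACA addNr add0r -mulrBl normrM (gtr0_norm h_gt0).
  rewrite ler_piMl ?(ltW h_gt0) //.
  have /andP[h1 h2] := av j.
  by rewrite distrC -natrB // normr_nat -[leRHS]/(1%:R) ler_nat; lia.
move: sa; rewrite /s; case: b => [/andP[]//|].
have [ai _|_ /negbT] := eqVneq (a i) 0%N; last by rewrite -ltNge => /ltW.
by rewrite mxE ai mul0r addr0; case/andP: (fM' (g a) i).
Qed.

(** A cluster point of the cubes found on finer and finer grids is fixed: near
    it every coordinate of [f y - y] takes both signs. *)
Lemma brouwer_bounded_pos (R : realType) m (M : R)
    (f : 'rV[R]_m.+1 -> 'rV[R]_m.+1) :
  continuous f -> (forall x i, `|f x 0 i| <= M) -> exists x, f x = x.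
Proof.
move=> cf fM0; pose M1 := `|M| + 1.
have M1_gt0 : 0 < M1 by rewrite ltr_wpDl.
have fM x i : `|f x 0 i| <= M1.
  by rewrite (le_trans (fM0 x i)) // (le_trans (ler_norm M)) // lerDl.
have /choice[u uP] : forall k, exists u : 'rV[R]_m.+1,
    (forall i, `|u 0 i| <= M1) /\
    forall i (b : bool), exists2 a : 'rV[R]_m.+1,
      forall j, `|u 0 j - a 0 j| <= 2 * M1 / k.+1%:R &
      if b then f a 0 i <= a 0 i else a 0 i <= f a 0 i.
  by move=> k; have [u ? ?] := brouwer_grid k M1_gt0 fM; exists u.
pose K := [set v : 'rV[R]_m.+1 | forall i, v ord0 i \in `[- M1, M1]].
have cK : compact K.
  apply: (@rV_compact _ _ (fun=> `[- M1, M1]%classic)) => _.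
  exact: segment_compact.
have uK : (u @ \oo) K.
  by exists 0%N => // k _ i; rewrite in_itv /= -ler_norml; case: (uP k).
have [x [_ xcl]] := cK (u @ \oo) _ uK; exists x.
have near_x i (b : bool) (e : R) : 0 < e -> exists2 a : 'rV[R]_m.+1, ball x e a &
    if b then f a 0 i <= a 0 i else a 0 i <= f a 0 i.
  move=> e_gt0; have e2 : 0 < e / 2 by rewrite divr_gt0.
  have [k0 k0P] : exists k0, 2 * M1 / (e / 2) < k0%:R.
    by exists (Num.truncn (2 * M1 / (e / 2))).+1; exact: truncnS_gt.
  have Tk : (u @ \oo) [set u k | k in [set k | (k0 <= k)%N]].
    by exists k0 => // k kk; exists k.
  have [_ [[k /= kk <-] [_ xu]]] := xcl _ _ Tk (nbhsx_ballx x _ e2).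
  have [_ /(_ i b)[a ua fa]] := uP k; exists a => //; split => // i0 j.
  rewrite !ord1; apply: (@le_lt_trans _ _ (`|x 0 j - u k 0 j| + `|u k 0 j - a 0 j|)).
    by rewrite -[x 0 j - a 0 j](subrKA (u k 0 j)) ler_normD.
  rewrite [ltRHS](splitr e) ltr_leD //; first exact: xu.
  rewrite (le_trans (ua j)) // ler_pdivrMr //.
  move: k0P; rewrite ltr_pdivrMr // => /ltW/le_trans; apply.
  by rewrite mulrC ler_pM2l // ler_nat; lia.
apply/rowP => i; apply/eqP; rewrite -subr_eq0; apply/eqP.
pose phi y := f y 0 i - y 0 i.
have cphi : continuous phi.
  move=> y; apply: (cvgB _ (@coord_continuous _ _ _ 0 i y)).
  exact: (continuous_comp (cf y) (@coord_continuous _ _ _ 0 i (f y))).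
rewrite -/(phi x); apply: le_anti; apply/andP; split.
  rewrite leNgt; apply/negP => phix.
  have /nbhs_ballP[e /= e0 eP] : \forall y \near x, 0 < phi y.
    exact: (cvgr_gt _ (cphi x)) phix.
  by have [a /eP /=] := near_x i true e e0; rewrite /phi subr_gt0 ltNge => /negP.
rewrite leNgt; apply/negP => phix.
have /nbhs_ballP[e /= e0 eP] : \forall y \near x, phi y < 0.
  exact: (cvgr_lt _ (cphi x)) phix.
by have [a /eP /=] := near_x i false e e0; rewrite /phi subr_lt0 ltNge => /negP.
Qed.

Theorem brouwer_bounded (R : realType) d (M : R) (f : 'rV[R]_d -> 'rV[R]_d) :
  continuous f -> (forall x i, `|f x 0 i| <= M) -> exists x, f x = x.
Proof.
case: d f => [|m] f; last exact: brouwer_bounded_pos.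
by exists 0; apply/rowP => -[].
Qed.

(** * Euclidean geometry of row vectors *)

Section Euclid.
Variables (R : realType) (d : nat).
Implicit Types (x y z : 'rV[R]_d) (a : R).

Lemma dotpC x y : dotp x y = dotp y x.
Proof. by apply: eq_bigr => i _; rewrite mulrC. Qed.

Lemma dotpDl x y z : dotp (x + y) z = dotp x z + dotp y z.
Proof. by rewrite -big_split; apply: eq_bigr => i _; rewrite mxE mulrDl. Qed.

Lemma dotpZl a x y : dotp (a *: x) y = a * dotp x y.
Proof. by rewrite mulr_sumr; apply: eq_bigr => i _; rewrite mxE mulrA. Qed.

Lemma dotpNl x y : dotp (- x) y = - dotp x y.
Proof. by rewrite -scaleN1r dotpZl mulN1r. Qed.

Lemma dotpBl x y z : dotp (x - y) z = dotp x z - dotp y z.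
Proof. by rewrite dotpDl dotpNl. Qed.

Lemma dotpDr x y z : dotp z (x + y) = dotp z x + dotp z y.
Proof. by rewrite ![dotp z _]dotpC dotpDl. Qed.

Lemma dotpZr a x y : dotp y (a *: x) = a * dotp y x.
Proof. by rewrite ![dotp y _]dotpC dotpZl. Qed.

Lemma dotpNr x y : dotp y (- x) = - dotp y x.
Proof. by rewrite ![dotp y _]dotpC dotpNl. Qed.

Definition dotpE := (dotpDl, dotpDr, dotpNl, dotpNr, dotpZl, dotpZr).

Lemma dotp_ge0 x : 0 <= dotp x x.
Proof. by apply: sumr_ge0 => i _; rewrite -expr2 sqr_ge0. Qed.

Lemma enorm_ge0 x : 0 <= enorm x.
Proof. exact: sqrtr_ge0. Qed.

Lemma sqr_enorm x : enorm x ^+ 2 = dotp x x.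
Proof. by rewrite sqr_sqrtr // dotp_ge0. Qed.

Lemma coord_le_enorm x i : `|x 0 i| <= enorm x.
Proof.
rewrite -(ler_pXn2r (n := 2)) ?nnegrE ?enorm_ge0 // sqr_enorm.
rewrite -normrX ger0_norm ?sqr_ge0 // /dotp (bigD1 i) //= expr2 lerDl.
by apply: sumr_ge0 => j _; rewrite -expr2 sqr_ge0.
Qed.

Lemma enorm0 : enorm (0 : 'rV[R]_d) = 0.
Proof. by rewrite /enorm /dotp big1 ?sqrtr0 // => i _; rewrite mxE mul0r. Qed.

Lemma enorm_eq0 x : enorm x = 0 -> x = 0.
Proof.
move=> x0; apply/rowP => i; rewrite mxE; apply/eqP; rewrite -normr_eq0.
by rewrite eq_le normr_ge0 andbT -x0 coord_le_enorm.
Qed.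

Lemma dotp_gt0 x : x != 0 -> 0 < dotp x x.
Proof.
move=> x0; rewrite lt_neqAle dotp_ge0 andbT eq_sym; apply: contra x0 => /eqP xx.
by apply/eqP/enorm_eq0; rewrite /enorm xx sqrtr0.
Qed.

Lemma enormZ a x : enorm (a *: x) = `|a| * enorm x.
Proof.
by rewrite /enorm dotpZl dotpZr mulrA -expr2 sqrtrM ?sqr_ge0 // sqrtr_sqr.
Qed.

Lemma enormN x : enorm (- x) = enorm x.
Proof. by rewrite -scaleN1r enormZ normrN1 mul1r. Qed.

Lemma enormC x y : enorm (x - y) = enorm (y - x).
Proof. by rewrite -enormN opprB. Qed.

Lemma cauchy_schwarz x y : dotp x y <= enorm x * enorm y.
Proof.
have [/eqP/enorm_eq0 ->|x0] := boolP (enorm x == 0).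
  by rewrite enorm0 mul0r -(scale0r 0) dotpZl mul0r.
have [/eqP/enorm_eq0 ->|y0] := boolP (enorm y == 0).
  by rewrite enorm0 mulr0 -(scale0r 0) dotpZr mul0r.
have xy : 0 < enorm x * enorm y.
  by rewrite mulr_gt0 // lt_neqAle eq_sym ?x0 ?y0 enorm_ge0.
have := dotp_ge0 (enorm y *: x - enorm x *: y).
rewrite !dotpE -!sqr_enorm (dotpC y x) => h.
rewrite -(ler_pM2l xy); nra.
Qed.

Lemma ler_enormD x y : enorm (x + y) <= enorm x + enorm y.
Proof.
rewrite -(ler_pXn2r (n := 2)) ?nnegrE ?addr_ge0 ?enorm_ge0 // sqr_enorm.
rewrite !dotpE -!sqr_enorm (dotpC y x); have := cauchy_schwarz x y; nra.
Qed.

Lemma ler_enormB_trans z x y : enorm (x - y) <= enorm (x - z) + enorm (z - y).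
Proof. by rewrite -[x - y](subrKA z) ler_enormD. Qed.

Lemma sqr_dotpBZ x y a :
  dotp (x - a *: y) (x - a *: y)
    = dotp x x - 2 * a * dotp x y + a ^+ 2 * dotp y y.
Proof. by rewrite !dotpE (dotpC y x); ring. Qed.

Lemma continuous_dotp (T : topologicalType) (f g : T -> 'rV[R]_d) :
  continuous f -> continuous g -> continuous (fun t => dotp (f t) (g t)).
Proof.
move=> cf cg; apply: continuous_big => [|i _ t].
  exact: add_continuous.
apply: cvgM.
  exact: (continuous_comp (cf t) (@coord_continuous _ _ _ 0 i (f t))).
exact: (continuous_comp (cg t) (@coord_continuous _ _ _ 0 i (g t))).
Qed.

Lemma continuous_enorm (T : topologicalType) (f : T -> 'rV[R]_d) :
  continuous f -> continuous (fun t => enorm (f t)).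
Proof.
move=> cf t.
apply: (@continuous_comp _ _ _ (fun t => dotp (f t) (f t)) (@Num.sqrt R)).
  exact: continuous_dotp.
exact: sqrt_continuous.
Qed.

End Euclid.

(** * Projections onto compact convex sets *)

Section Sets.
Variables (R : realType) (d : nat).
Implicit Types (x y z : 'rV[R]_d) (A B : set 'rV[R]_d).

Lemma continuous_subl y : continuous (fun b : 'rV[R]_d => y - b).
Proof. by move=> b; exact: (cvgB (cvg_cst y) (@cvg_id _ (nbhs b))). Qed.

Lemma has_inf_dist y A : A !=set0 -> has_inf [set enorm (y - b) | b in A].
Proof.
move=> [b Ab]; split; first by exists (enorm (y - b)), b.
by exists 0 => _ [c _ <-]; exact: enorm_ge0.
Qed.

Lemma dist_pt_le y A b : A b -> dist_pt y A <= enorm (y - b).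
Proof.
move=> Ab; apply: ge_inf; last by exists b.
by exists 0 => _ [c _ <-]; exact: enorm_ge0.
Qed.

Lemma ProjP y A : CC A -> A (Proj y A) /\ enorm (y - Proj y A) = dist_pt y A.
Proof.
move=> [A0 cA _].
have [|c /set_mem Ac cmin] := @EVT_min_rV R d (fun b => enorm (y - b)) A A0 cA.
  by apply: continuous_subspaceT; apply: continuous_enorm; exact: continuous_subl.
have H : exists p, [set p | A p /\ enorm (y - p) = dist_pt y A] p.
  exists c; split=> //; apply: le_anti; rewrite dist_pt_le // andbT.
  apply: lb_le_inf; first by case: (has_inf_dist y A0).
  by move=> _ [b Ab <-]; apply: cmin; exact/mem_set.
exact: xgetPex H.
Qed.

Lemma dist_pt_ge0 y A : CC A -> 0 <= dist_pt y A.
Proof. by move=> /(ProjP y)[_ <-]; exact: enorm_ge0. Qed.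

Lemma CC_conv A x y (t : R) : CC A -> A x -> A y -> 0 <= t <= 1 ->
  A (t *: x + (1 - t) *: y).
Proof.
move=> [_ _ cA] Ax Ay t01.
have /andP[t0 t1] := t01.
pose l := Itv01 t0 t1.
by have /set_mem := cA x y l (mem_set Ax) (mem_set Ay).
Qed.

Lemma Proj_variational y A b : CC A -> A b ->
  dotp (y - Proj y A) (b - Proj y A) <= 0.
Proof.
move=> cA Ab; have [Ap pE] := ProjP y cA; set p := Proj y A in Ap pE *.
rewrite leNgt; apply/negP => pos.
pose D := dotp (b - p) (b - p); pose P := dotp (y - p) (b - p).
have D0 : 0 <= D by exact: dotp_ge0.
(* Moving from [p] towards [b] by this fraction would beat the distance. *)
pose t := P / (P + D).
have PD : 0 < P + D by rewrite ltr_pwDl.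
have t0 : 0 < t by rewrite divr_gt0.
have t1 : t <= 1 by rewrite ler_pdivrMr // mul1r lerDl.
have tE : t * (P + D) = P by rewrite divfK // gt_eqF.
have := dist_pt_le y (CC_conv (t := t) cA Ab Ap _); rewrite (ltW t0) t1 => /(_ isT).
rewrite -pE -(ler_pXn2r (n := 2)) ?nnegrE ?enorm_ge0 // !sqr_enorm.
have -> : y - (t *: b + (1 - t) *: p) = (y - p) - t *: (b - p).
  by apply/rowP => i; rewrite !mxE; ring.
rewrite sqr_dotpBZ -/P -/D.
have tD : t * D = P - t * P by rewrite -{1}tE; ring.
have : 0 < t * (P + t * P) by rewrite mulr_gt0 // addr_gt0 // mulr_gt0.
have -> : t ^+ 2 * D = t * (P - t * P) by rewrite -tD; ring.
lra.
Qed.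

(** Compactness turns the supremum and the infimum in the Hausdorff distance
    into a statement about points. *)
Lemma dist_H_point A B (w : R) a : CC A -> CC B -> dist_H A B <= w -> A a ->
  exists2 b, B b & enorm (a - b) <= w.
Proof.
move=> cA cB ABw Aa; have [Bp pE] := ProjP a cB; exists (Proj a B) => //.
rewrite pE (le_trans _ ABw) // /dist_H le_max; apply/orP; left.
apply: ub_le_sup; last by exists a.
case: (cA) (cB) => A0 compA _ [[b0 Bb0] _ _].
have [|c _ cmax] := @EVT_max_rV R d (fun x => enorm (x - b0)) A A0 compA.
  apply: continuous_subspaceT; apply: continuous_enorm => x.
  exact: (cvgB (@cvg_id _ (nbhs x)) (cvg_cst b0)).
exists (enorm (c - b0)) => _ [x Ax <-].
by rewrite (le_trans (dist_pt_le _ Bb0)) // cmax //; exact/mem_set.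
Qed.

Lemma Proj_mem y A : CC A -> A y -> Proj y A = y.
Proof.
move=> cA Ay; have := Proj_variational y cA Ay; rewrite -sqr_enorm => h.
have /eqP : enorm (y - Proj y A) ^+ 2 = 0.
  by apply: le_anti; rewrite h sqr_ge0.
by rewrite expf_eq0 /= => /eqP/enorm_eq0/eqP; rewrite subr_eq0 => /eqP.
Qed.

Lemma dist_pt_lip y A B (w : R) : CC A -> CC B -> dist_H A B <= w ->
  dist_pt y B <= dist_pt y A + w.
Proof.
move=> cA cB ABw; have [Ap pE] := ProjP y cA.
have [b Bb pb] := dist_H_point cA cB ABw Ap.
rewrite (le_trans (dist_pt_le y Bb)) // (le_trans (ler_enormB_trans (Proj y A) _ _)) //.
by rewrite pE lerD2l.
Qed.

(** Adding the variational inequalities at the two projections, each tested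
    with a point of its own set that is within [w] of the other projection,
    gives Hölder continuity with exponent 1/2 of the projection in the set. *)
Lemma Proj_holder y A B (w : R) : CC A -> CC B -> dist_H A B <= w ->
  enorm (Proj y A - Proj y B) ^+ 2 <= w * (dist_pt y A + dist_pt y B).
Proof.
move=> cA cB ABw; have [Ap pE] := ProjP y cA; have [Bq qE] := ProjP y cB.
have BAw : dist_H B A <= w by rewrite /dist_H maxC.
set p := Proj y A in Ap pE *; set q := Proj y B in Bq qE *.
have [b Bb pb] := dist_H_point cA cB ABw Ap.
have [a Aa qa] := dist_H_point cB cA BAw Bq.
have := Proj_variational y cA Aa; have := Proj_variational y cB Bb.
rewrite -/p -/q => hb ha.
have h1 := cauchy_schwarz (y - p) (q - a); have h2 := cauchy_schwarz (y - q) (p - b).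
rewrite pE in h1; rewrite qE in h2.
have h3 := ler_wpM2l (dist_pt_ge0 y cA) qa; have h4 := ler_wpM2l (dist_pt_ge0 y cB) pb.
rewrite sqr_enorm; move: ha hb h1 h2 h3 h4; rewrite !dotpE.
rewrite (dotpC q p); lra.
Qed.

End Sets.

(** * Convergence of row vectors *)

Lemma cvg_enorm (R : realType) d (T : Type) (G : set_system T) {FG : Filter G}
    (f : T -> 'rV[R]_d) (y : 'rV[R]_d) :
  enorm (f t - y) @[t --> G] --> 0 -> f t @[t --> G] --> y.
Proof.
move=> /cvgrPdist_lt fy; apply/cvg_ballP => e e0; near=> t.
split=> // i j; rewrite !ord1 /ball /=.
have : enorm (f t - y) < e.
  suff : `|0 - enorm (f t - y)| < e by rewrite sub0r normrN ger0_norm ?enorm_ge0.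
  by near: t; exact: fy.
apply: le_lt_trans; rewrite enormC.
by have := coord_le_enorm (y - f t) j; rewrite !mxE.
Unshelve. all: by end_near. Qed.

Lemma cvg_coord (R : realType) d (T : Type) (G : set_system T) {FG : Filter G}
    (f : T -> 'rV[R]_d) (y : 'rV[R]_d) :
  (forall i, f t 0 i @[t --> G] --> y 0 i) -> f t @[t --> G] --> y.
Proof.
move=> fy; apply/cvg_ballP => e e0; near=> t.
split=> // i j; rewrite !ord1; move: j; near: t.
apply: filter_forall => j; exact: (cvg_ball (fy j)).
Unshelve. all: by end_near. Qed.

(** Adding to a coordinate of [x n] the remaining length [r n] of the geometric
    path makes it nonincreasing, so each coordinate converges. *)
Lemma cvg_geometric_steps (R : realType) d (x : nat -> 'rV[R]_d) (C q : R) :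
  0 <= C -> 0 <= q < 1 ->
  (forall n, enorm (x n - x n.+1) <= C * q ^+ n) ->
  exists2 y : 'rV[R]_d, x n @[n --> \oo] --> y &
    forall n, enorm (x n - y) <= C * (q ^+ n / (1 - q)).
Proof.
move=> C_ge0 /andP[q_ge0 q_lt1] xs; pose r n := C * (q ^+ n / (1 - q)).
have q1 : 0 < 1 - q by rewrite subr_gt0.
have q1n : 1 - q != 0 by rewrite gt_eqF.
have r_ge0 n : 0 <= r n by rewrite mulr_ge0 // divr_ge0 ?exprn_ge0 // ltW.
have rS n : r n.+1 + C * q ^+ n = r n by rewrite /r exprS; field.
have tail n k : enorm (x n - x (n + k)%N) <= r n - r (n + k)%N.
  elim: k => [|k IH]; first by rewrite addn0 !subrr enorm0.
  apply: le_trans (ler_enormB_trans (x (n + k)%N) _ _) _.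
  by have := xs (n + k)%N; have := rS (n + k)%N; rewrite addnS; lra.
have r0 : r n @[n --> \oo] --> 0.
  have -> : 0 = C * (0 / (1 - q)) by rewrite mul0r mulr0.
  apply: cvgM; first exact: cvg_cst.
  apply: cvgM; last exact: cvg_cst.
  by apply: cvg_expr; rewrite ger0_norm.
have coord_cvg i : cvgn (fun n => x n 0 i).
  have ci n k : `|x n 0 i - x (n + k)%N 0 i| <= r n - r (n + k)%N.
    apply: le_trans (tail n k).
    by have := coord_le_enorm (x n - x (n + k)%N) i; rewrite !mxE.
  have cu : cvgn (fun n => x n 0 i + r n).
    apply: nonincreasing_is_cvgn.
      apply/nonincreasing_seqP => n; have := ci n 1%N.
      by rewrite addn1 ler_norml => /andP[]; lra.
    exists (x 0%N 0 i - r 0%N) => _ [n _ <-].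
    have := ci 0%N n; rewrite add0n ler_norml => /andP[_].
    by have := r_ge0 n; lra.
  have -> : (fun n => x n 0 i) = (fun n => (x n 0 i + r n) - r n).
    by apply/funext => n; rewrite addrK.
  by apply: is_cvgB => //; apply/cvg_ex; exists 0.
pose y : 'rV[R]_d := \row_i limn (fun n => x n 0 i).
have xy : x n @[n --> \oo] --> y.
  by apply: cvg_coord => i; rewrite mxE; exact: coord_cvg.
exists y => // n.
have ce : continuous (fun t : 'rV[R]_d => enorm (x n - t)).
  by apply: continuous_enorm; exact: continuous_subl.
have cn : enorm (x n - x k) @[k --> \oo] --> enorm (x n - y).
  exact: (cvg_comp _ _ xy (ce y)).
apply: (cvgr_to_le cn).
exists n => // k /= nk; have := tail n (k - n)%N; rewrite subnKC //.
by rewrite -/(r n); have := r_ge0 k; lra.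
Unshelve. all: by end_near. Qed.

(** * A radial retraction onto a ball through the origin *)

Section RadialRetraction.
Variables (R : realType) (d : nat) (a : R) (v : 'rV[R]_d).
Hypothesis a_gt0 : 0 < a.

(** On each ray from the origin this scales down to the ball
    [a |z|^2 <= <v, z>], whose boundary contains the origin. At [z = 0] the
    quotient is 0 by convention and only the product with [z] matters. *)
Definition radial_scale (z : 'rV[R]_d) : R :=
  Num.min 1 (Num.max 0 (dotp v z) / (a * dotp z z)).

Definition radial_retr (z : 'rV[R]_d) : 'rV[R]_d := radial_scale z *: z.

Lemma radial_scale_itv z : 0 <= radial_scale z <= 1.
Proof.
rewrite /radial_scale ge_min lexx le_min ler01 /= andbT divr_ge0 //.
  by rewrite le_max lexx.
by rewrite mulr_ge0 ?dotp_ge0 // ltW.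
Qed.

Lemma radial_scale_lt1 z : z != 0 -> radial_scale z < 1 ->
  radial_scale z * (a * dotp z z) = Num.max 0 (dotp v z).
Proof.
move=> z0; have zz : a * dotp z z != 0 by rewrite gt_eqF // mulr_gt0 // dotp_gt0.
rewrite {1}/radial_scale gt_min ltxx /= => /ltW r1.
by rewrite /radial_scale min_r // divfK.
Qed.

Lemma radial_scale_le z :
  radial_scale z * (a * dotp z z) <= Num.max 0 (dotp v z).
Proof.
have [->|z0] := eqVneq z 0.
  by rewrite -(scale0r 0) !dotpZr !mul0r !mulr0 le_max lexx.
have [/(radial_scale_lt1 z0) -> //|t1] := ltP (radial_scale z) 1.
have zz : 0 < a * dotp z z by rewrite mulr_gt0 // dotp_gt0.
by rewrite -ler_pdivlMr // /radial_scale ge_min lexx orbT.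
Qed.

Lemma radial_retr_in z :
  a * dotp (radial_retr z) (radial_retr z) <= dotp v (radial_retr z).
Proof.
have [vz|/ltW vz] := leP (dotp v z) 0.
  have -> : radial_retr z = 0.
    by rewrite /radial_retr /radial_scale max_l // mul0r min_r // scale0r.
  by rewrite -(scale0r 0) !dotpZr !mul0r mulr0.
have /andP[t0 _] := radial_scale_itv z.
rewrite /radial_retr dotpZl !dotpZr mulrCA ler_wpM2l // mulrCA.
by have := radial_scale_le z; rewrite max_r.
Qed.

Lemma enorm_radial_retr z : enorm (radial_retr z) <= enorm v / a.
Proof.
have := radial_retr_in z; have := cauchy_schwarz v (radial_retr z).
rewrite -sqr_enorm ler_pdivlMr // => h1 h2.
have [/eqP ->|r0] := boolP (enorm (radial_retr z) == 0).
  by rewrite mul0r enorm_ge0.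
have r_gt0 : 0 < enorm (radial_retr z) by rewrite lt_neqAle eq_sym r0 enorm_ge0.
by rewrite -(ler_pM2r r_gt0); lra.
Qed.

Lemma continuous_radial_retr : continuous radial_retr.
Proof.
have cid : continuous (fun z : 'rV[R]_d => z).
  by move=> z; exact: (@cvg_id _ (nbhs z)).
have ccst w : continuous (fun _ : 'rV[R]_d => w : 'rV[R]_d).
  by move=> z; exact: cst_continuous.
move=> z; have [->|z0] := eqVneq z 0.
  have r0 : radial_retr 0 = 0 by rewrite /radial_retr scaler0.
  rewrite /continuous_at r0.
  apply: (@cvg_enorm _ _ _ (nbhs (0 : 'rV[R]_d))).
  apply: (@squeeze_cvgr _ _ _ _ (fun=> 0) (fun t : 'rV[R]_d => enorm t)).
  - near=> t; rewrite subr0 enorm_ge0 /= enormZ.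
    have /andP[t0 t1] := radial_scale_itv t.
    by rewrite ger0_norm // ler_piMl // enorm_ge0.
  - exact: cvg_cst.
  - have ce : continuous (fun t : 'rV[R]_d => enorm t) by exact: continuous_enorm.
    by have := ce 0; rewrite /continuous_at enorm0.
apply: (@cvgZ _ _ _ (nbhs z)); last exact: cid.
apply: (@continuous_min _ _ (fun=> 1)
  (fun t => Num.max 0 (dotp v t) / (a * dotp t t)) z).
  exact: cst_continuous.
apply: (@cvgM _ _ (nbhs z)).
  apply: (@continuous_max _ _ (fun=> 0) (fun t => dotp v t) z).
    exact: cst_continuous.
  have cv : continuous (fun t => dotp v t) by exact: continuous_dotp.
  exact: cv.
apply: (@cvgV _ _ (nbhs z)).
  by rewrite gt_eqF // mulr_gt0 // dotp_gt0.
apply: (@cvgM _ _ (nbhs z)); first exact: cvg_cst.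
have czz : continuous (fun t : 'rV[R]_d => dotp t t) by exact: continuous_dotp.
exact: czz.
Unshelve. all: by end_near. Qed.

End RadialRetraction.

(** * The residual and the iteration step *)

Section Iteration.
Variables (R : realType) (d : nat) (l L : R) (F : 'rV[R]_d -> set 'rV[R]_d).
Variable ybar : 'rV[R]_d.
Hypothesis F_CC : forall z, CC (F z).
Hypothesis l_lt0 : l < 0.
Hypothesis F_ROSL : ROSL l F.
Hypothesis F_Lip : Lipschitz_mv L F.

Let res (z : 'rV[R]_d) := ybar - Proj ybar (F z).

Lemma lip_point x x' y : F x y ->
  exists2 y', F x' y' & enorm (y - y') <= L * enorm (x - x').
Proof. by move=> Fxy; apply: dist_H_point Fxy => //; exact: F_Lip.2. Qed.

(** From the point of [F 0] that maximizes [<., u>], the relaxed condition gains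
    at least [- l |u|^2] on the way to [F (- u)], and the way back to [F 0]
    loses at most [L |u|^2]. *)
Lemma rosl_le_lip : (0 < d)%N -> - l <= L.
Proof.
move=> d_gt0; pose u : 'rV[R]_d := const_mx 1.
have u_gt0 : 0 < enorm u.
  apply: lt_le_trans (coord_le_enorm u (Ordinal d_gt0)).
  by rewrite mxE normr1.
have [F0 cF _] := F_CC 0.
have [|y /set_mem Fy ymax] := @EVT_max_rV R d (fun y => dotp y u) (F 0) F0 cF.
  apply: continuous_subspaceT; apply: continuous_dotp => t.
    exact: (@cvg_id _ (nbhs t)).
  exact: cst_continuous.
have [y' Fy'] := F_ROSL (- u) Fy; rewrite sub0r opprK => yy'.
have [y2 Fy2] := lip_point 0 Fy'; rewrite subr0 enormN => y'y2.
have := ymax y2 (mem_set Fy2); have := cauchy_schwarz (y' - y2) u.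
have := ler_wpM2r (ltW u_gt0) y'y2; move: yy'; rewrite !dotpBl => h1 h2 h3 h4.
by rewrite -(ler_pM2r u_gt0) -(ler_pM2r u_gt0); lra.
Qed.

(** The auxiliary point is [z = x' + nu h e(x')] with [h = - l / L^2]. It gives
    [|e(x')|^2 <= <e(x), e(x')> + L |z - x| |e(x')| - (l / L)^2 nu |e(x')|^2],
    where [z - x = h (nu e(x') - e(x))]; splitting the middle product by the
    arithmetic-geometric inequality with weight [nu] cancels the mixed term
    [<e(x), e(x')>]. *)
Lemma contraction_family x x' (nu : R) : 0 < L -> 0 < nu ->
  x' = x + (l / L ^+ 2) *: res x ->
  2 * nu * dotp (res x') (res x') <=
    nu ^+ 2 * (1 - (l / L) ^+ 2) * dotp (res x') (res x') + dotp (res x) (res x).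
Proof.
move=> L_gt0 nu_gt0 x'E; set e := res x in x'E *; set e' := res x'.
pose h := - l / L ^+ 2.
have L0 : L != 0 by rewrite gt_eqF.
have h_gt0 : 0 < h by rewrite divr_gt0 ?oppr_gt0 ?exprn_gt0.
pose z := x' + (nu * h) *: e'.
have zx : z - x = h *: (nu *: e' - e).
  by rewrite /z x'E; apply/rowP => i; rewrite !mxE /h; field.
have zx' : z - x' = (nu * h) *: e' by rewrite /z addrC addKr.
have [Fp _] := ProjP ybar (F_CC x); set p := Proj ybar (F x) in Fp.
have [q Fq pq] := lip_point z Fp.
have [y' Fy' qy'] := F_ROSL x' Fq.
have var := Proj_variational ybar (F_CC x') Fy'.
have {}qy' : dotp (q - y') e' <= l * (nu * h) * dotp e' e'.
  move: qy'; rewrite zx' sqr_enorm !dotpE => qy'.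
  by rewrite -(ler_pM2l (mulr_gt0 nu_gt0 h_gt0)); lra.
set W := enorm (nu *: e' - e).
have {}pq : enorm (p - q) <= L * h * W.
  by rewrite enormC -opprB enormN enormC zx enormZ (gtr0_norm h_gt0) mulrA in pq.
have cs := cauchy_schwarz (p - q) e'.
have W2 : W ^+ 2 = nu ^+ 2 * dotp e' e' - 2 * nu * dotp e e' + dotp e e.
  by rewrite /W enormC sqr_enorm sqr_dotpBZ; ring.
have De' : enorm e' ^+ 2 = dotp e' e' by rewrite sqr_enorm.
have pqe := ler_wpM2r (enorm_ge0 e') pq.
have main : dotp e' e' <= dotp e e' + L * h * W * enorm e' + l * (nu * h) * dotp e' e'.
  have decomp : dotp e' e' = dotp e e' + dotp (p - q) e' + dotp (q - y') e'
      + dotp e' (y' - Proj ybar (F x')).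
    rewrite (dotpC e' (y' - _)) -!dotpDl; congr (dotp _ _).
    by rewrite /e /e' /res -/p; apply/rowP => i; rewrite !mxE; ring.
  by move: var; rewrite -/(res x') -/e'; lra.
have sq := sqr_ge0 (nu * (L * h) * enorm e' - W).
have Lh : L * h = - (l / L) by rewrite /h; field.
have lh : l * h = - (l / L) ^+ 2 by rewrite /h; field.
have m2 := ler_wpM2l (ltW nu_gt0) main.
have E1 : (nu * (L * h) * enorm e' - W) ^+ 2
   = nu ^+ 2 * (l / L) ^+ 2 * dotp e' e' - 2 * (nu * (L * h * W * enorm e')) + W ^+ 2.
  by rewrite -De' Lh; ring.
have E2 : nu * (l * (nu * h) * dotp e' e') = - (nu ^+ 2 * (l / L) ^+ 2 * dotp e' e').
  by rewrite [l * _]mulrCA lh; ring.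
rewrite E1 W2 in sq; move: m2; rewrite !mulrDr E2; lra.
Qed.

(** With [q = kappa^2] the best parameter is [nu = 1 / q]; if [q = 0] one lets
    [nu] grow. *)
Lemma contraction x x' : (0 < d)%N -> x' = x + (l / L ^+ 2) *: res x ->
  dotp (res x') (res x') <= (1 - (l / L) ^+ 2) * dotp (res x) (res x).
Proof.
move=> d_gt0 x'E; have lL := rosl_le_lip d_gt0.
have L_gt0 : 0 < L by apply: lt_le_trans lL; rewrite oppr_gt0.
have fam nu nu0 := @contraction_family x x' nu L_gt0 nu0 x'E.
move: fam (dotp_ge0 (res x')) (dotp_ge0 (res x)).
have : 0 <= 1 - (l / L) ^+ 2.
  rewrite subr_ge0 -sqrrN -mulNr expr_le1 ?divr_ge0 ?oppr_ge0 ?(ltW l_lt0) ?(ltW L_gt0) //.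
  by rewrite ler_pdivrMr // mul1r.
move: (1 - _) (dotp (res x') _) (dotp (res x) _) => q D' D.
rewrite le_eqVlt => /predU1P[<-|q_gt0] fam D'0 D0.
  rewrite mul0r leNgt; apply/negP => D'_gt0.
  have := fam ((D + 1) / D'); rewrite divr_gt0 ?ltr_wpDl // => /(_ isT).
  by rewrite mulr0 mul0r add0r -mulrA divfK ?gt_eqF //; lra.
have := fam q^-1; rewrite invr_gt0 => /(_ q_gt0).
have q0 : q != 0 by rewrite gt_eqF.
have -> : q^-1 ^+ 2 * q = q^-1 by field.
move=> h; rewrite -(ler_pM2l (_ : 0 < q^-1)) ?invr_gt0 // mulrA mulVf // mul1r; lra.
Qed.

Lemma continuous_Proj : continuous (fun z => Proj ybar (F z)).
Proof.
move=> z; apply: (@cvg_enorm _ _ _ (nbhs z)).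
have csub : continuous (fun t : 'rV[R]_d => enorm (z - t)).
  by apply: continuous_enorm; exact: continuous_subl.
pose w t := L * enorm (z - t).
have wz : w t @[t --> z] --> 0.
  have -> : 0 = L * enorm (z - z) by rewrite subrr enorm0 mulr0.
  by apply: (@cvgM _ _ (nbhs z)); [exact: cvg_cst|exact: csub].
pose D := dist_pt ybar (F z).
apply: (@squeeze_cvgr _ _ _ _ (fun=> 0)
  (fun t => Num.sqrt (w t * (D + (D + w t))))).
- near=> t; rewrite enorm_ge0 /= -[leLHS]ger0_norm ?enorm_ge0 // -sqrtr_sqr.
  have wt : dist_H (F z) (F t) <= w t by exact: F_Lip.2.
  have w0 : 0 <= w t by rewrite mulr_ge0 ?enorm_ge0 ?F_Lip.1.
  rewrite enormC ler_wsqrtr // (le_trans (Proj_holder ybar _ _ wt)) //.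
  by rewrite ler_wpM2l // lerD2l; exact: dist_pt_lip.
- exact: cvg_cst.
have -> : 0 = Num.sqrt (0 * (D + (D + 0))) by rewrite mul0r sqrtr0.
have cs : continuous (fun r : R => Num.sqrt (r * (D + (D + r)))).
  move=> r.
  apply: (@continuous_comp _ _ _ (fun r : R => r * (D + (D + r))) (@Num.sqrt R)).
    apply: (@cvgM _ _ (nbhs r)); first exact: cvg_id.
    apply: (@cvgD _ _ _ (nbhs r)); first exact: cvg_cst.
    by apply: (@cvgD _ _ _ (nbhs r)); [exact: cvg_cst|exact: cvg_id].
  exact: sqrt_continuous.
exact: (cvg_comp _ _ wz (cs 0)).
Unshelve. all: by end_near. Qed.

(** The ball [- l |x - xb|^2 <= <e(x), x - xb>] is where the solution would lie
    if [F] were single-valued. With a set-valued [F] not every solution is in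
    it; a topological argument finds one that is. *)
Lemma localized_solution x : exists2 xb, F xb ybar &
  - l * dotp (x - xb) (x - xb) <= dotp (res x) (x - xb).
Proof.
have a_gt0 : 0 < - l by rewrite oppr_gt0.
pose v := - res x; pose rho := radial_retr (- l) v.
pose f z := rho z + (Proj ybar (F (x + rho z)) - ybar).
have crho : continuous rho by exact: continuous_radial_retr.
have cf : continuous f.
  move=> z; apply: (@cvgD _ _ _ (nbhs z)); first exact: crho.
  apply: (@cvgB _ _ _ (nbhs z)); last exact: cvg_cst.
  apply: (@continuous_comp _ _ _ (fun z => x + rho z) (fun t => Proj ybar (F t))).
    by apply: (@cvgD _ _ _ (nbhs z)); [exact: cvg_cst|exact: crho].
  exact: continuous_Proj.
pose B := enorm v / - l.
have fB z i : `|f z 0 i| <= B + (dist_pt ybar (F x) + L * B).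
  apply: le_trans (coord_le_enorm _ _) _.
  have rB : enorm (rho z) <= B by exact: enorm_radial_retr.
  apply: le_trans (ler_enormD _ _) (lerD rB _).
  have [_ pE] := ProjP ybar (F_CC (x + rho z)); rewrite enormC pE.
  apply: (le_trans (dist_pt_lip ybar (F_CC x) _ (F_Lip.2 x (x + rho z)))) => //.
  by rewrite lerD2l ler_wpM2l ?F_Lip.1 // opprD addNKr enormN.
have [z fz] := brouwer_bounded cf fB.
have gE : Proj ybar (F (x + rho z)) - ybar = (1 - radial_scale (- l) v z) *: z.
  apply/eqP; rewrite scalerBl scale1r eq_sym subr_eq addrC eq_sym.
  exact/eqP.
have rin := radial_retr_in v a_gt0 z; rewrite -/rho in rin.
exists (x + rho z); last first.
  by rewrite opprD addNKr !dotpNl !dotpNr opprK -dotpNl.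
have [FP _] := ProjP ybar (F_CC (x + rho z)).
suff P0 : Proj ybar (F (x + rho z)) = ybar by rewrite P0 in FP.
apply/eqP; rewrite -subr_eq0 gE.
have /andP[t0 t1] := radial_scale_itv v a_gt0 z.
set t := radial_scale (- l) v z in gE t0 t1 *.
have [->|z0] := eqVneq z 0; first by rewrite scaler0.
have [-> |t_neq1] := eqVneq t 1; first by rewrite subrr scale0r.
have tlt : t < 1 by rewrite lt_neqAle t_neq1.
have tE := radial_scale_lt1 a_gt0 z0 tlt; rewrite -/t in tE.
(* The remaining case is absurd: the residual at [x + rho z] would point along
   [- z], while [F (x + rho z)] has a point [y'] with [<y' - ybar, z> <= 0]. *)
have [Fp _] := ProjP ybar (F_CC x).
have [y' Fy' /= yz] : exists2 y', F (x + rho z) y' & dotp (y' - ybar) z <= 0.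
  have [vz|vz] := leP (dotp v z) 0.
    have t00 : t = 0 by rewrite /t /radial_scale max_l // mul0r min_r.
    exists (Proj ybar (F x)); first by rewrite /rho /radial_retr -/t t00 scale0r addr0.
    by move: vz; rewrite /v /res opprB.
  have [y' Fy' yr] := F_ROSL (x + rho z) Fp; exists y' => //.
  rewrite max_r ?(ltW vz) // in tE.
  have t_gt0 : 0 < t.
    rewrite lt_neqAle t0 andbT eq_sym; apply: contraTneq vz => tt.
    by rewrite -tE tt mul0r ltxx.
  move: yr; rewrite opprD addNKr sqr_enorm dotpNr dotpNl dotpNr opprK.
  rewrite /rho /radial_retr -/t dotpZl !dotpZr => yr.
  have E : dotp (y' - ybar) z = dotp v z - dotp (Proj ybar (F x) - y') z.
    rewrite -dotpBl; congr (dotp _ _).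
    by rewrite /v /res; apply/rowP => i; rewrite !mxE; ring.
  by rewrite E -tE -(ler_pM2l t_gt0); lra.
have var := Proj_variational ybar (F_CC (x + rho z)) Fy'.
have var2 : dotp ((1 - t) *: z) ((1 - t) *: z) <= dotp (y' - ybar) ((1 - t) *: z).
  rewrite -gE; move: var; set P := Proj _ _ => var.
  have -> : dotp (y' - ybar) (P - ybar)
      = dotp (y' - P) (P - ybar) + dotp (P - ybar) (P - ybar).
    by rewrite -dotpDl subrKA.
  by rewrite lerDr dotpC -[P - ybar]opprB dotpNl oppr_ge0.
rewrite [leRHS]dotpZr in var2.
apply/eqP/enorm_eq0; rewrite /enorm; apply/eqP; rewrite sqrtr_eq0.
apply: (le_trans var2); rewrite mulr_ge0_le0 //; lra.
Qed.

Lemma sqr_dist_pt_res x : dist_pt ybar (F x) ^+ 2 = dotp (res x) (res x).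
Proof. by have [_ <-] := ProjP ybar (F_CC x); rewrite sqr_enorm. Qed.

(** In [|x' - xb|^2 = |x - xb|^2 - 2 h <e(x), x - xb> + h^2 |e(x)|^2] with
    [h = - l / L^2], the ball bounds the mixed term by [2 (l / L)^2 |x - xb|^2].
    The total coefficient [1 - 2 (l / L)^2] of [|x - xb|^2] is then nonpositive,
    so that the lower bound [|x - xb| >= |e(x)| / L] applies. *)
Lemma solution_near_step x x' : (0 < d)%N -> L <= - Num.sqrt 2 * l ->
  x' = x + (l / L ^+ 2) *: res x ->
  exists2 xb, F xb ybar &
    enorm (x' - xb) <= - (1 / (2 * l)) * dist_pt ybar (F x).
Proof.
move=> d_gt0 L_le x'E; have [xb Fxb loc] := localized_solution x; exists xb => //.
have L_gt0 : 0 < L by apply: lt_le_trans (rosl_le_lip d_gt0); rewrite oppr_gt0.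
have a_gt0 : 0 < - l by rewrite oppr_gt0.
have D_ge0 := dist_pt_ge0 ybar (F_CC x).
have L2 : L ^+ 2 <= 2 * l ^+ 2.
  rewrite -[2](@sqr_sqrtr _ 2) // -exprMn -(sqrrN (_ * l)) -mulNr.
  by rewrite ler_pXn2r // nnegrE ?(ltW L_gt0) // mulNr -mulrN mulr_ge0 ?sqrtr_ge0 // ltW.
have DE : dist_pt ybar (F x) ^+ 2 <= L ^+ 2 * dotp (x - xb) (x - xb).
  rewrite -sqr_enorm -exprMn ler_pXn2r // ?nnegrE ?mulr_ge0 ?enorm_ge0 ?(ltW L_gt0) //.
  have := dist_pt_lip ybar (F_CC xb) (F_CC x) (F_Lip.2 xb x).
  have [_ <-] := ProjP ybar (F_CC xb).
  by rewrite Proj_mem // subrr enorm0 add0r enormC.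
have rhs : 0 <= - (1 / (2 * l)) * dist_pt ybar (F x).
  by rewrite mul1r -invrN -mulrN mulr_ge0 // invr_ge0 mulr_ge0 // ltW.
rewrite -(ler_pXn2r (n := 2)) ?nnegrE ?enorm_ge0 // sqr_enorm exprMn.
rewrite sqr_dist_pt_res in DE *.
have -> : x' - xb = (x - xb) - (- (l / L ^+ 2)) *: res x.
  by rewrite x'E; apply/rowP => i; rewrite !mxE; ring.
rewrite sqr_dotpBZ (dotpC _ (res x)).
move: loc DE (dotp_ge0 (res x)) (dotp_ge0 (x - xb)).
move: (dotp (x - xb) _) (dotp (res x) (x - xb)) (dotp (res x) (res x)) => E P D loc DE D0 E0.
pose c2 := l ^+ 2 / L ^+ 2.
have L0 : L != 0 by rewrite gt_eqF.
have l0 : l != 0 by rewrite lt_eqF.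
have c2L : c2 * L ^+ 2 = l ^+ 2 by rewrite divfK // expf_neq0.
have Lp : 0 < L ^+ 2 by rewrite exprn_gt0.
have c2_half : 1 <= 2 * c2 by rewrite -(ler_pM2r Lp); lra.
have lp : 0 < l ^+ 2 by rewrite exprn_even_gt0.
have h1 : - (l / L ^+ 2) * P >= c2 * E.
  have -> : c2 * E = - (l / L ^+ 2) * (- l * E) by rewrite /c2; field.
  apply: ler_wpM2l; [by rewrite -mulNr divr_ge0 // ltW|exact: loc].
have h2 : (- (l / L ^+ 2)) ^+ 2 * D = c2 / L ^+ 2 * D by rewrite /c2; field.
have h3 : (- (1 / (2 * l))) ^+ 2 * D = (4 * c2)^-1 * (D / L ^+ 2).
  by rewrite /c2; field; rewrite l0 L0.
rewrite h2 h3; pose G := D / L ^+ 2.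
have G0 : 0 <= G by rewrite divr_ge0 // ltW.
have GE : G <= E by rewrite ler_pdivrMr // mulrC.
have -> : c2 / L ^+ 2 * D = c2 * G by rewrite /G; ring.
rewrite -/G.
have c2p : 0 < c2 by lra.
have k : 1 - c2 <= (4 * c2)^-1.
  have p4 : 0 < 4 * c2 by lra.
  rewrite -(ler_pM2r p4) mulVf ?(gt_eqF p4) //.
  have := sqr_ge0 (2 * c2 - 1); lra.
have := ler_wpM2r G0 k.
have : (2 * c2 - 1) * G <= (2 * c2 - 1) * E by rewrite ler_wpM2l //; lra.
lra.
Qed.

End Iteration.

(** * Convergence of the iteration *)

Theorem proposition10 (R : realType) (d : nat) (l L : R)
    (F : 'rV[R]_d -> set 'rV[R]_d) (x0 ybar : 'rV[R]_d)
    (x : nat -> 'rV[R]_d)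
    (F_CC : forall z : 'rV[R]_d, CC (F z))
    (l_lt0 : l < 0)
    (F_ROSL : ROSL l F)
    (F_Lip : Lipschitz_mv L F)
    (d_gt1 : (1 < d)%N)
    (L_le : L <= - Num.sqrt 2 * l)
    (x_init : x 0%N = x0)
    (x_step : forall n : nat,
      x n.+1 = x n + (l / L ^+ 2) *: (ybar - Proj ybar (F (x n)))) :
  let kappa := Num.sqrt (L ^+ 2 - l ^+ 2) / L in
  exists xbar : 'rV[R]_d,
    [/\ solset F ybar xbar,
        x n @[n --> \oo] --> xbar &
        forall n : nat, (1 <= n)%N ->
          dist_pt (x n) (solset F ybar)
            <= - (1 / (2 * l)) * kappa ^+ n.-1 * dist_pt ybar (F x0)
          /\ enorm (x n - xbar)
            <= - (l / L ^+ 2) * (kappa ^+ n / (1 - kappa))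
               * dist_pt ybar (F x0)].
Proof.
move=> kappa; have d_gt0 : (0 < d)%N := ltnW d_gt1.
have lL := rosl_le_lip F_CC F_ROSL F_Lip d_gt0.
have a_gt0 : 0 < - l by rewrite oppr_gt0.
have L_gt0 : 0 < L by exact: lt_le_trans lL.
have L0 : L != 0 by rewrite gt_eqF.
have lL2 : l ^+ 2 <= L ^+ 2 by rewrite -sqrrN ler_pXn2r // nnegrE ltW.
have kappa_ge0 : 0 <= kappa by rewrite divr_ge0 ?sqrtr_ge0 // ltW.
have kappa2 : kappa ^+ 2 = 1 - (l / L) ^+ 2.
  by rewrite exprMn sqr_sqrtr ?subr_ge0 //; field.
have kappa_lt1 : kappa < 1.
  rewrite -(ltr_pXn2r (n := 2)) ?nnegrE // expr1n kappa2 gtrBl.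
  by rewrite exprn_even_gt0 //= mulf_neq0 ?invr_neq0 // lt_eqF.
pose delta n := dist_pt ybar (F (x n)).
have delta_ge0 n : 0 <= delta n by exact: dist_pt_ge0.
have deltaS n : delta n.+1 <= kappa * delta n.
  rewrite -(ler_pXn2r (n := 2)) ?nnegrE ?(mulr_ge0 kappa_ge0) // exprMn kappa2 /delta.
  rewrite !(sqr_dist_pt_res _ F_CC).
  exact: (contraction F_CC l_lt0 F_ROSL F_Lip d_gt0 (x_step n)).
have delta_le n : delta n <= kappa ^+ n * delta 0%N.
  elim: n => [|n IH]; first by rewrite mul1r.
  by rewrite exprS -mulrA (le_trans (deltaS n)) // ler_wpM2l.
have h_gt0 : 0 < - (l / L ^+ 2) by rewrite -mulNr divr_gt0 // exprn_gt0.
have step_le n :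
    enorm (x n - x n.+1) <= - (l / L ^+ 2) * delta 0%N * kappa ^+ n.
  rewrite x_step opprD addNKr enormN enormZ ltr0_norm -?oppr_gt0 //.
  have [_ ->] := ProjP ybar (F_CC (x n)).
  by rewrite -mulrA ler_pM2l // mulrC; exact: delta_le.
have [||xbar xcvg xle] := cvg_geometric_steps _ _ step_le.
- by rewrite mulr_ge0 // ltW.
- by rewrite kappa_ge0.
exists xbar; split=> //; last first.
  case=> // n _; split; last by rewrite mulrAC -x_init; exact: xle.
  have [xb Fxb xbE] :=
    solution_near_step F_CC l_lt0 F_ROSL F_Lip d_gt0 L_le (x_step n).
  apply: le_trans (dist_pt_le _ (Fxb : solset F ybar xb)) _.
  apply: (le_trans xbE); rewrite -mulrA ler_wpM2l //=.
    by rewrite mul1r -invrN -mulrN invr_ge0 mulr_ge0 // ltW.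
  by rewrite -x_init; exact: delta_le.
have dist0 : dist_pt ybar (F xbar) <= 0.
  pose b n := kappa ^+ n * delta 0%N
    + L * (- (l / L ^+ 2) * delta 0%N * (kappa ^+ n / (1 - kappa))).
  have b0 : b n @[n --> \oo] --> 0.
    have -> : 0 = 0 * delta 0%N
        + L * (- (l / L ^+ 2) * delta 0%N * (0 / (1 - kappa))).
      by rewrite !mul0r !mulr0 addr0.
    have kn : kappa ^+ n @[n --> \oo] --> 0 by apply: cvg_expr; rewrite ger0_norm.
    apply: cvgD; first by apply: cvgM => //; exact: cvg_cst.
    apply: cvgM; first exact: cvg_cst.
    apply: cvgM; first exact: cvg_cst.
    by apply: cvgM => //; exact: cvg_cst.
  apply: (cvgr_to_ge b0).
  near=> n.
  apply: le_trans (dist_pt_lip ybar (F_CC (x n)) (F_CC xbar) (F_Lip.2 (x n) xbar)) _.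
  by rewrite lerD ?delta_le // ler_wpM2l // ltW.
have [FP PE] := ProjP ybar (F_CC xbar).
have /enorm_eq0/eqP : enorm (ybar - Proj ybar (F xbar)) = 0.
  by apply: le_anti; rewrite enorm_ge0 PE dist0.
by rewrite subr_eq0 => /eqP yE; rewrite /solset /= yE.
Unshelve. all: by end_near. Qed.
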